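(* We have $$\dim_H\big(\{\beta\in(1,2): \overline{E_\beta^+}\text{ is a Cantor set}\}\big)=0.$$
   Context: For $\beta\in(1,2)$ the $\beta$-transformation is $T_\beta:[0,1)\to[0,1)$, $T_\beta(x)=\beta x \pmod 1$, and $E_\beta^+=\{t\in[0,1): T_\beta^n(t)\ge t\text{ for all }n\ge 0\}$. The overline denotes topological closure and $\dim_H$ Hausdorff dimension. *)

(* Defs.v *)
From mathcomp Require Import all_boot all_order all_algebra.
From mathcomp Require Import all_classical all_reals all_analysis.

Set Implicit Arguments.
Unset Strict Implicit.
Unset Printing Implicit Defensive.

Import Order.TTheory GRing.Theory Num.Theory.
Import numFieldNormedType.Exports.

Local Open Scope classical_set_scope.
Local Open Scope ring_scope.

(* The formula is total on R; it maps `[0, 1[ to itself and is only iterated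
   from points of `[0, 1[ below. *)
Definition beta_transf {R : realType} (b x : R) : R :=
  b * x - (Num.floor (b * x))%:~R.

Definition E_plus {R : realType} (b : R) : set R :=
  [set t | 0 <= t < 1 /\ forall n : nat, t <= iter n (beta_transf b) t].

Definition cantor_set {T : topologicalType} (A : set T) : Prop :=
  [/\ A !=set0, compact A, perfect_set A & totally_disconnected A].

Local Open Scope ereal_scope.

Definition diameter {R : realType} (A : set R) : \bar R :=
  ereal_sup [set `|p.1 - p.2|%:E | p in A `*` A].

(* The empty set has weight 0 for every s, whereas a singleton has weight
   0 `^ 0 = 1 for s = 0, so that the exponent 0 yields the counting measure. *)
Definition diam_pow {R : realType} (s : R) (A : set R) : \bar R :=
  if A == set0 then 0 else diameter A `^ s.

Definition hausdorff_content {R : realType} (s delta : R) (A : set R) :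
    \bar R :=
  ereal_inf [set \sum_(0 <= i <oo) diam_pow s (U i) | U in
    [set U : (set R)^nat | A `<=` \bigcup_i U i /\
                           forall i, diameter (U i) <= delta%:E]].

(* The supremum is the limit as delta tends to 0 from above, the content being
   nonincreasing in delta. *)
Definition hausdorff_measure {R : realType} (s : R) (A : set R) : \bar R :=
  ereal_sup [set hausdorff_content s delta A | delta in [set d : R | (0 < d)%R]].

Definition hausdorff_dim {R : realType} (A : set R) : \bar R :=
  ereal_inf [set s%:E | s in [set s : R | (0 <= s)%R /\
                                          hausdorff_measure s A = 0]].

(* Main.v *)
Require Import Defs.
From mathcomp Require Import all_boot all_order all_algebra.
From mathcomp Require Import all_classical all_reals all_analysis.
From mathcomp Require Import zify lra ring.

Import Order.TTheory GRing.Theory Num.Theory.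
Import numFieldNormedType.Exports.

(** The idea is to read off the quasi-greedy expansion a of 1 in base b (here
called the kneading sequence of b) that isolated points are absent, and to see
that only very few sequences a survive.

Isolated points.  If a_m = 1, the word a_0 ... a_(m-1) 0 is the itinerary of a
point p of period m+1.  Let t be the least point of its orbit; it belongs to
the bifurcation set.  A point of the bifurcation set just below t would be
pushed further below by T^(m+1), and a point just above t is driven away from
the orbit of p until it crosses the discontinuity next to p, after which it
falls below the m+1-st point tau_(m+1) of the orbit of 1.  So t is isolated
unless t < tau_(m+1) [periodic_orbit_below].  Lexicographically, a cannot drop
after a_m below every tail of the periodic sequence
(a_0 ... a_(m-1) 0)^infinity; this and the maximality of a among its tails is
[cantor_kneading].

Renormalization.  Such a sequence a cannot contain both 00 and 11: it starts
with 10 or with 11; in the first case maximality forbids 11, in the second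
case the condition at the last 11 before the first 00 is violated.  Hence a is
the image of a sequence a' under one of the substitutions 0 -> 0, 1 -> 10 or
0 -> 10, 1 -> 1, and a' inherits all conditions
[cantor_kneading_desubst].  Iterating,
a is an image under arbitrarily long compositions of the two substitutions
(such sequences are balanced).

Counting.  The lengths (x, y) of the images of 0 and 1 change by
(x, y) -> (x, x + y) or (x + y, y), so by the Euclidean algorithm they determine
the composition [node_inj], and the composition determines the first x + y - 1
letters of a [node_common_prefix].  As x + y at most doubles at each step, the
admissible prefixes of length about M fall into at most (2M+1)^2 classes,
whereas bases b >= rho > 1 with equal first L + 1 letters are within distance
rho^(-L) [kneading_close].  Polynomially many sets of exponentially small
diameter give Hausdorff measure 0 in every positive dimension
[hausdorff_null_cantor_kneading], and letting rho tend to 1 is a countable union. *)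

(** * Binary sequences and the lexicographic order *)

Definition tail (n : nat) (x : nat -> bool) : nat -> bool := fun i => x (n + i).

Lemma tail_tail m n x : tail m (tail n x) = tail (n + m) x.
Proof. by apply/funext => i; rewrite /tail addnA. Qed.

Definition lexlt (x y : nat -> bool) : Prop :=
  exists k, [/\ forall i, i < k -> x i = y i, x k = false & y k].

Lemma lexlt_cons (x y : nat -> bool) : x 0 = y 0 -> lexlt (tail 1 x) (tail 1 y) -> lexlt x y.
Proof.
move=> xy0 [k [xy xk yk]]; exists k.+1; split => //.
by case=> [//|i] ik; apply: xy.
Qed.

Lemma lexlt_tail (x y : nat -> bool) : x 0 = y 0 -> lexlt x y -> lexlt (tail 1 x) (tail 1 y).
Proof.
move=> xy0 [[|k] [xy xk yk]]; first by rewrite xy0 yk in xk.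
by exists k; split => // i ik; apply: xy.
Qed.

Lemma lexlt_headN (x y : nat -> bool) : x 0 -> y 0 = false -> ~ lexlt x y.
Proof.
move=> x0 y0 [[|k] [xy xk yk]]; first by rewrite x0 in xk.
by move: (xy 0 isT); rewrite x0 y0.
Qed.

(** * Images of sequences under substitutions *)

Definition image_prefix (u : bool -> seq bool) (z : nat -> bool) (n : nat) :=
  flatten [seq u (z i) | i <- iota 0 n].

(** The infinite sequence x is the image of z under the substitution u. A
relation avoids choosing the position of each letter of x in the blocks. *)
Definition is_image (u : bool -> seq bool) (z x : nat -> bool) : Prop :=
  forall n i, i < size (image_prefix u z n) ->
    x i = nth false (image_prefix u z n) i.

Definition nonerasing (u : bool -> seq bool) := forall b, 0 < size (u b).

Lemma image_prefixD u z m n :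
  image_prefix u z (m + n) = image_prefix u z m ++ image_prefix u (tail m z) n.
Proof.
rewrite /image_prefix iotaD map_cat flatten_cat add0n; congr (_ ++ flatten _).
by rewrite -[m in iota m n]addn0 iotaDl -map_comp.
Qed.

Lemma image_prefix1 u z : image_prefix u z 1 = u (z 0).
Proof. by rewrite /image_prefix /= cats0. Qed.

Lemma image_prefixS u z n : image_prefix u z n.+1 = image_prefix u z n ++ u (z n).
Proof. by rewrite -addn1 image_prefixD image_prefix1 /tail addn0. Qed.

Lemma eq_image_prefix u z w n :
  (forall i, i < n -> z i = w i) -> image_prefix u z n = image_prefix u w n.
Proof.
move=> zw; congr flatten; apply/eq_in_map => i.
by rewrite mem_iota => /andP[_ /zw ->].
Qed.

Lemma size_image_prefix_ge u z n : nonerasing u -> n <= size (image_prefix u z n).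
Proof.
move=> u0; elim: n => // n IH; rewrite image_prefixS size_cat.
by have := u0 (z n); lia.
Qed.

Lemma is_image_tail u z x i : is_image u z x ->
  is_image u (tail i z) (tail (size (image_prefix u z i)) x).
Proof.
move=> zx n j jn; rewrite /tail (zx (i + n)) image_prefixD ?size_cat.
  by rewrite nth_cat ltnNge leq_addr /= addKn.
by rewrite ltn_add2l.
Qed.

Lemma is_image_at u z x i j : is_image u z x -> j < size (u (z i)) ->
  x (size (image_prefix u z i) + j) = nth false (u (z i)) j.
Proof.
move=> /(is_image_tail _ _ _ i)/(_ 1 j); rewrite image_prefix1 /tail addn0.
by move=> /[apply].
Qed.

(** Every position is covered, since n blocks have at least n letters. *)
Lemma is_image_uniq u z x x' : nonerasing u ->
  is_image u z x -> is_image u z x' -> x =1 x'.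
Proof.
move=> u0 zx zx' i.
by rewrite (zx i.+1) ?(zx' i.+1)//; exact: size_image_prefix_ge.
Qed.

Lemma is_image_exists u z : nonerasing u -> exists x, is_image u z x.
Proof.
move=> u0; exists (fun i => nth false (image_prefix u z i.+1) i) => n i iz.
have [le|/ltnW le] := leqP i.+1 n.
  rewrite -(subnKC le) image_prefixD nth_cat.
  by rewrite (size_image_prefix_ge _ _ i.+1 u0).
by rewrite -(subnKC le) image_prefixD nth_cat iz.
Qed.

Lemma eq_is_image u z z' x : z =1 z' -> is_image u z x -> is_image u z' x.
Proof.
move=> zz zx n i; rewrite (eq_image_prefix _ _ z) => [|j _]; last by rewrite zz.
exact: zx.
Qed.

Lemma image_block u z k : nonerasing u ->
  exists i j, j < size (u (z i)) /\ k = size (image_prefix u z i) + j.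
Proof.
move=> u0.
have ex : exists i, size (image_prefix u z i) <= k by exists 0.
have ub i : size (image_prefix u z i) <= k -> i <= k.
  exact/leq_trans/size_image_prefix_ge.
have [i ik imax] := ex_maxnP ex ub.
exists i, (k - size (image_prefix u z i)); split; last by rewrite subnKC.
rewrite ltn_subLR// -size_cat -image_prefixS ltnNge; apply/negP => /imax.
by rewrite ltnn.
Qed.

(** The two elementary substitutions of Sturmian words: [esubst false] inserts
a 0 after each 1, [esubst true] inserts a 1 before each 0. *)
Definition esubst (c b : bool) : seq bool :=
  match c, b with
  | false, false => [:: false]
  | true, true => [:: true]
  | _, _ => [:: true; false]
  end.

Lemma esubst_nonerasing c : nonerasing (esubst c).
Proof. by case: c => -[]. Qed.

(** The substitution that applies [esubst c] first and then u. *)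
Definition comp_esubst (u : bool -> seq bool) (c b : bool) : seq bool :=
  flatten [seq u d | d <- esubst c b].

Lemma is_image_comp u c z' z x :
  is_image u z x -> is_image (esubst c) z' z -> is_image (comp_esubst u c) z' x.
Proof.
move=> zx z'z n i.
have -> : image_prefix (comp_esubst u c) z' n =
          image_prefix u z (size (image_prefix (esubst c) z' n)).
  have zE : [seq z i | i <- iota 0 (size (image_prefix (esubst c) z' n))] =
      image_prefix (esubst c) z' n.
    apply: (@eq_from_nth _ false); first by rewrite size_map size_iota.
    move=> k; rewrite size_map size_iota => kn.
    by rewrite (nth_map 0) ?size_iota// nth_iota// add0n; apply: z'z.
  rewrite /(image_prefix u) (map_comp u z) zE /image_prefix /comp_esubst.
  by elim: (iota 0 n) => //= j s ->; rewrite map_cat flatten_cat.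
exact: zx.
Qed.

(** At the first difference the images of 0 and 1 differ at once for
[esubst false]; for [esubst true] they are 10 and 1, and the latter is followed
by a 1 because every block starts with 1. *)
Lemma is_image_esubst_lexlt c z w x y :
  is_image (esubst c) z x -> is_image (esubst c) w y ->
  lexlt z w -> lexlt x y.
Proof.
move=> zx wy [k [zw zk wk]].
have eP := eq_image_prefix (esubst c) _ _ _ zw.
have pre i : i < size (image_prefix (esubst c) z k) -> x i = y i.
  by move=> ik; rewrite (zx k)// (wy k) -?eP.
set L := size (image_prefix (esubst c) z k) in pre.
have xat := is_image_at _ _ _ k _ zx; have yat := is_image_at _ _ _ k _ wy.
rewrite -/L zk in xat; rewrite -eP -/L wk in yat.
destruct c; rewrite /= in xat yat.
  exists L.+1; split; last first.
  - have := is_image_at _ _ _ k.+1 0 wy; rewrite image_prefixS size_cat -eP wk /=.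
    by rewrite addn0 addn1 => ->; case: (w k.+1).
  - by rewrite -addn1; apply: xat.
  - move=> i; rewrite ltnS leq_eqVlt => /orP[/eqP->|/pre//].
    by rewrite -[L]addn0 xat// yat.
exists L; split => //; rewrite -[L]addn0 ?xat ?yat//.
Qed.

(** * Renormalization of kneading sequences *)

(** The combinatorial trace of a perfect bifurcation set. The sequence y
is (a_0 ... a_(m-1) 0)^infinity; the third condition says that the tail of a
after a_m = 1 is not smaller than all tails of y, since otherwise the least
point of the periodic orbit with itinerary y would be isolated. *)
Definition cantor_kneading (a : nat -> bool) : Prop :=
  [/\ a 0, forall i, ~ lexlt a (tail i a) &
      forall m y, a m -> (forall i, y (m.+1 + i) = y i) ->
        (forall i, i < m -> y i = a i) -> y m = false ->
        exists k, ~ lexlt (tail m.+1 a) (tail k y)].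

Lemma cantor_kneading_no11 a : cantor_kneading a -> a 1 = false ->
  forall i, a i -> a i.+1 = false.
Proof.
move=> [a0 amax _] a1 i ai; apply/negbTE/negP => ai1.
apply: (amax i); exists 1; split => //; last by rewrite /tail addn1.
by case=> // _; rewrite /tail addn0 a0 ai.
Qed.

(** The least sequence without 00 is (01)^infinity, and f falls below it at
position D + 1. *)
Lemma lexlt_alternating f g D : ~~ odd D ->
  (forall i, i <= D -> f i = odd i) -> f D.+1 = false ->
  (forall i, g i = false -> g i.+1) -> lexlt f g.
Proof.
move=> De fo fD g00.
have [/forallP /= go|] := boolP [forall i : 'I_D.+1, g i == odd i].
  have gE i : i <= D -> g i = odd i.
    by rewrite -ltnS => iD; exact/eqP/(go (Ordinal iD)).
  exists D.+1; split => // [i iD|]; first by rewrite fo ?gE.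
  by apply: g00; rewrite gE//; apply/negbTE.
rewrite negb_forall => /existsP[/= i0 gi0].
have ex : exists i, (i <= D) && (g i != odd i).
  by exists i0; rewrite gi0 andbT -ltnS ltn_ord.
have [i /andP[iD gi] imin] := ex_minnP ex.
have eqg j : j < i -> g j = odd j.
  move=> ji; apply/eqP; apply/negPn/negP => gj.
  by have := imin j; rewrite gj andbT; lia.
have ei : odd i = false.
  apply/negbTE/negP => oi; case: i oi iD gi imin eqg => // i /= oi iD gi _ eqg.
  by move: gi; rewrite g00 ?eqg ?oi//; apply/negbTE.
exists i; split; rewrite ?fo//; last by move: gi; rewrite ei; case: (g i).
by move=> j ji; rewrite fo ?eqg//; lia.
Qed.

(** Otherwise take the last 11 before the first 00, and let m be the position
of its second 1. After it the sequence reads 0 1 0 1 ... 0 1 0 0, which is less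
than (01)^infinity, whereas (a_0 ... a_(m-1) 0)^infinity does not contain 00, so all
its tails are at least (01)^infinity. *)
Lemma cantor_kneading_no00 a : cantor_kneading a -> a 1 ->
  forall i, a i = false -> a i.+1.
Proof.
move=> [a0 amax ast] a1 i ai; apply/negPn/negP => ai1.
have ex00 : exists i, ~~ a i && ~~ a i.+1 by exists i; rewrite ai ai1.
move=> {i ai ai1}; have [m /andP[am am1] mmin] := ex_minnP ex00.
have no00 i : i < m -> a i = false -> a i.+1.
  move=> im ai; apply/negPn/negP => ai1.
  by have := mmin i; rewrite ai ai1 => /(_ isT); lia.
have m2 : 1 < m by case: m am {am1 mmin no00} => [|[|m]]//; rewrite ?a0 ?a1.
have ex11 : exists n, [&& n < m, a n & a n.+1] by exists 0; rewrite a0 a1; lia.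
have ub n : [&& n < m, a n & a n.+1] -> n <= m by case/and3P; lia.
have [n /and3P[nm an an1] nmax] := ex_maxnP ex11 ub.
have n1m : n.+1 < m.
  by rewrite ltn_neqAle nm andbT; apply: contraTneq an1 => ->.
have no11 i : n < i -> i < m -> a i -> a i.+1 = false.
  move=> ni im ai; apply/negbTE/negP => ai1.
  by have := nmax i; rewrite im ai ai1 => /(_ isT); lia.
have alt i : n.+2 + i <= m -> a (n.+2 + i) = odd i.
  elim: i => [|i IH] im; first by rewrite addn0 no11.
  have := IH ltac:(lia); rewrite addnS /=; case: (odd i) => /= ai.
    by apply: no11 => //; lia.
  by rewrite no00//; lia.
pose y i := if i %% n.+2 == n.+1 then false else a (i %% n.+2).
have ylt i : i < n.+1 -> y i = a i.
  by move=> il; rewrite /y modn_small ?ifN//; lia.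
have [||||k] := ast n.+1 y => //.
- by move=> i; rewrite /y modnDl.
- by rewrite /y modn_small// eqxx.
apply; apply: (lexlt_alternating _ _ (m - n.+2)).
- by rewrite -alt subnKC.
- by move=> i im; apply: alt; lia.
- by rewrite /tail addnS subnKC//; apply/negbTE.
- move=> i; rewrite /tail addnS.
  move: (k + i) => {k}{}i; rewrite /y.
  have -> : i.+1 %% n.+2 = (i %% n.+2).+1 %% n.+2.
    by rewrite -addn1 -modnDml addn1.
  have : i %% n.+2 < n.+2 by rewrite ltn_mod.
  move: (i %% n.+2) => j; rewrite ltnS leq_eqVlt => /orP[/eqP->|jn].
    by rewrite modnn /= a0.
  rewrite ifN; last by lia.
  rewrite modn_small; last by lia.
  move=> aj; have aj1 : a j.+1 by apply: no00 => //; lia.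
  rewrite ifN//; apply: contraFneq aj => -[->]; exact: an.
Qed.

(** Parse a from left to right; pos n is the start of the n-th block. *)
Lemma preimage_no11 (a : nat -> bool) : a 0 -> (forall i, a i -> a i.+1 = false) ->
  exists z, is_image (esubst false) z a.
Proof.
move=> a0 no11.
pose pos k := iter k (fun p => if a p then p.+2 else p.+1) 0.
have posS k : pos k.+1 = if a (pos k) then (pos k).+2 else (pos k).+1 by [].
pose z k := a (pos k); exists z.
have H n : size (image_prefix (esubst false) z n) = pos n /\
  forall i, i < pos n -> a i = nth false (image_prefix (esubst false) z n) i.
  elim: n => [//|n [IHs IH]]; rewrite image_prefixS size_cat IHs; split.
    by rewrite posS /z; case: (a (pos n)); rewrite /= ?addn1 ?addn2.
  move=> i; rewrite nth_cat IHs; have [/IH //|pi] := ltnP i (pos n).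
  rewrite posS /z; case: ifP => [ap|ap] ip.
    have [->|->] : i = pos n \/ i = (pos n).+1 by lia.
      by rewrite subnn ap.
    by rewrite no11// subSnn.
  have -> : i = pos n by lia.
  by rewrite subnn ap.
by move=> n i; have [-> /[apply]] := H n.
Qed.

Lemma preimage_no00 (a : nat -> bool) : a 0 -> (forall i, a i = false -> a i.+1) ->
  exists z, is_image (esubst true) z a.
Proof.
move=> a0 no00.
pose pos k := iter k (fun p => if a p.+1 then p.+1 else p.+2) 0.
have posS k : pos k.+1 = if a (pos k).+1 then (pos k).+1 else (pos k).+2 by [].
pose z k := a (pos k).+1; exists z.
have H n : [/\ size (image_prefix (esubst true) z n) = pos n, a (pos n) &
  forall i, i < pos n -> a i = nth false (image_prefix (esubst true) z n) i].
  elim: n => [//|n [IHs ap IH]]; rewrite image_prefixS size_cat IHs; split.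
  - by rewrite posS /z; case: (a (pos n).+1); rewrite /= ?addn1 ?addn2.
  - by rewrite posS; case: ifP => [//|/no00].
  move=> i; rewrite nth_cat IHs; have [/IH //|pi] := ltnP i (pos n).
  rewrite posS /z; case: ifP => [ap1|ap1] ip.
    have -> : i = pos n by lia.
    by rewrite subnn ap.
  have [->|->] : i = pos n \/ i = (pos n).+1 by lia.
    by rewrite subnn ap.
  by rewrite ap1 subSnn.
by move=> n i; have [-> _ /[apply]] := H n.
Qed.

Lemma image_periodic u y Y m : nonerasing u -> is_image u y Y ->
  (forall i, y (m + i) = y i) ->
  forall i, Y (size (image_prefix u y m) + i) = Y i.
Proof.
move=> u0 yY per.
apply: (is_image_uniq u y _ _ u0 _ yY).
apply: (eq_is_image u (tail m y) y _ per).
exact: is_image_tail.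
Qed.

(** The periodic sequences match: if z_m = 1 then the block of z_m in a is 10,
replacing z_m by 0 turns it into 0, which is the replacement of its first
letter 1 by 0 followed by a cut just after that letter. Hence the image of the
periodic sequence defined by z and m is the one defined by a and the position
of that 1. *)
Lemma cantor_kneading_preimage_no11 a z : cantor_kneading a -> a 1 = false ->
  is_image (esubst false) z a -> cantor_kneading z.
Proof.
move=> ka a1 za; have [a0 amax ast] := ka.
have az i : a (size (image_prefix (esubst false) z i)) = z i.
  by have := is_image_at _ _ _ i 0 za; rewrite addn0 => ->; case: (z i).
split.
- by rewrite -az.
- move=> i zi; apply: (amax (size (image_prefix (esubst false) z i))).
  exact: is_image_esubst_lexlt za (is_image_tail _ _ _ _ za) zi.
move=> m y zm yper yz ym.
have [Y yY] := is_image_exists _ y (esubst_nonerasing false).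
have eP := eq_image_prefix (esubst false) _ _ _ yz.
set P := size (image_prefix (esubst false) z m).
have aP : a P by rewrite az.
have aP1 : a P.+1 = false by apply: cantor_kneading_no11.
have SP : size (image_prefix (esubst false) y m.+1) = P.+1.
  by rewrite image_prefixS size_cat eP ym addn1.
have SPz : size (image_prefix (esubst false) z m.+1) = P.+2.
  by rewrite image_prefixS size_cat zm addn2.
have [||||k kP] := ast P Y => //.
- by have := image_periodic _ _ _ _ (esubst_nonerasing _) yY yper; rewrite SP.
- by move=> i iP; rewrite (yY m) eP// (za m).
- have := is_image_at _ _ _ m 0 yY; rewrite eP addn0 -/P => ->; by rewrite ym.
have Yk : Y k = false.
  apply/negbTE/negP => Yk; apply: kP; exists 0.
  by split; rewrite // /tail addn0.
(* A 0 ends its block, in a as well as in Y; cutting there leaves images. *)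
have [i [j [ji kE]]] := image_block _ y k (esubst_nonerasing false).
have kE' : size (image_prefix (esubst false) y i.+1) = k.+1.
  move: (is_image_at _ _ _ _ _ yY ji); rewrite -kE Yk image_prefixS size_cat kE.
  by move: j ji {kE} => [|[|j]]; case: (y i) => //=; rewrite ?addnS ?addn0.
exists i.+1 => lt; apply: kP; apply: lexlt_cons.
  by rewrite /tail !addn0 Yk aP1.
rewrite !tail_tail !addn1 -SPz -kE'.
exact: is_image_esubst_lexlt (is_image_tail _ _ _ _ za)
  (is_image_tail _ _ _ _ yY) lt.
Qed.

(** If z_m = 1, its block in a is the letter 1 and the next letter of a is also
1, as every block starts with 1. Replacing z_m by 0 turns this 11 into 10, so
here the periodic sequence for z and m corresponds to the one for a and the
position following the block. *)
Lemma cantor_kneading_preimage_no00 a z : cantor_kneading a -> a 1 ->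
  is_image (esubst true) z a -> cantor_kneading z.
Proof.
move=> ka a1 za; have [a0 amax ast] := ka.
have az0 w x i : is_image (esubst true) w x ->
    x (size (image_prefix (esubst true) w i)).
  by move=> wx; have := is_image_at _ _ _ i 0 wx; rewrite addn0 => ->; case: (w i).
have az1 i : a (size (image_prefix (esubst true) z i)).+1 = z i.
  case zi: (z i).
    by have := az0 _ _ i.+1 za; rewrite image_prefixS size_cat zi addn1.
  by have := is_image_at _ _ _ i 1 za; rewrite zi addn1 => ->.
split.
- by rewrite -az1.
- move=> i zi; apply: (amax (size (image_prefix (esubst true) z i))).
  exact: is_image_esubst_lexlt za (is_image_tail _ _ _ _ za) zi.
move=> m y zm yper yz ym.
have [Y yY] := is_image_exists _ y (esubst_nonerasing true).
have eP := eq_image_prefix (esubst true) _ _ _ yz.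
set P := size (image_prefix (esubst true) z m).
have aP : a P by apply: az0.
have SPz : size (image_prefix (esubst true) z m.+1) = P.+1.
  by rewrite image_prefixS size_cat zm addn1.
have aP1 : a P.+1 by rewrite -SPz az0.
have SP : size (image_prefix (esubst true) y m.+1) = P.+2.
  by rewrite image_prefixS size_cat eP ym addn2.
have YP := is_image_at _ _ _ m _ yY; rewrite eP -/P ym in YP.
have [||||k kP] := ast P.+1 Y => //.
- by have := image_periodic _ _ _ _ (esubst_nonerasing _) yY yper; rewrite SP.
- move=> i; rewrite ltnS leq_eqVlt => /orP[/eqP->|iP].
    by rewrite aP -[P]addn0 YP.
  by rewrite (yY m) eP// (za m).
- by rewrite -addn1 YP.
(* A tail of Y that starts with 0 becomes an image once the preceding 1 is put
   back; the same 1 precedes the tail of a. *)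
case Yk: (Y k); last first.
  have [i [j [ji kE]]] := image_block _ y k (esubst_nonerasing true).
  have kE' : k = (size (image_prefix (esubst true) y i)).+1.
    move: (is_image_at _ _ _ _ _ yY ji); rewrite -kE Yk kE.
    by move: j ji {kE} => [|[|j]]; case: (y i) => //=; rewrite ?addn1.
  exists i => lt; apply: kP.
  have := is_image_esubst_lexlt _ _ _ _ _ (is_image_tail _ _ _ m.+1 za)
    (is_image_tail _ _ _ i yY) lt.
  move=> /lexlt_tail; rewrite !tail_tail !addn1 SPz -kE'; apply.
  by rewrite /tail !addn0 aP1 az0.
(* Now the tail of z starts with 1, and that of y at m starts with 0. *)
have aP2 : a P.+2.
  by apply/negPn/negP => /negbTE aP2; apply: kP; exists 0; split => //;
    rewrite /tail addn0.
exists m; apply: lexlt_headN; rewrite /tail addn0//.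
by rewrite -az1 SPz.
Qed.

Lemma cantor_kneading_desubst a : cantor_kneading a ->
  exists c z, cantor_kneading z /\ is_image (esubst c) z a.
Proof.
move=> ka; have [a0 _ _] := ka; case a1: (a 1).
  have [z za] := preimage_no00 _ a0 (cantor_kneading_no00 _ ka a1).
  by exists true, z; split => //; apply: cantor_kneading_preimage_no00 za.
have [z za] := preimage_no11 _ a0 (cantor_kneading_no11 _ ka a1).
by exists false, z; split => //; apply: cantor_kneading_preimage_no11 za.
Qed.

(** * Iterated renormalization and the length of common prefixes *)

(** The composition of the elementary substitutions listed in s, the head of s
being applied first, so that a further renormalization extends s by a head. *)
Fixpoint node (s : seq bool) : bool -> seq bool :=
  if s is c :: s' then comp_esubst (node s') c else fun b => [:: b].

Lemma size_node_cons c s b : size (node (c :: s) b) =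
  size (node s b) + (b != c) * size (node s c).
Proof.
by rewrite /= /comp_esubst; case: c b => -[] /=; rewrite ?cats0 ?size_cat /=; lia.
Qed.

Lemma node_nonerasing s : nonerasing (node s).
Proof.
by elim: s => [//|c s IH] b; rewrite size_node_cons; have := IH b; lia.
Qed.

(** The lengths (x, y) of the images of 0 and 1 arise from (1, 1) by steps to
(x, x + y) or (x + y, y), and the larger entry shows which step was the last. *)
Lemma node_inj s s' :
  (forall b, size (node s b) = size (node s' b)) -> s = s'.
Proof.
elim: s s' => [|c s IH] [|c' s'] // sE.
- have := sE false; have := sE true; rewrite !size_node_cons /=.
  have := node_nonerasing s' false; have := node_nonerasing s' true.
  by case: c' {sE} => /=; lia.
- have := sE false; have := sE true; rewrite !size_node_cons /=.
  have := node_nonerasing s false; have := node_nonerasing s true.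
  by case: c {sE} => /=; lia.
have := sE false; have := sE true; rewrite !size_node_cons /=.
have := node_nonerasing s false; have := node_nonerasing s true.
have := node_nonerasing s' false; have := node_nonerasing s' true.
case: c sE; case: c' => sE /=; rewrite ?mul0n ?mul1n ?addn0; try lia;
  by move=> *; congr (_ :: _); apply: IH => -[]; lia.
Qed.

Lemma common_prefix_cons u k :
  (forall z z' x x', is_image u z x -> is_image u z' x' ->
    forall i, i < k -> x i = x' i) ->
  forall z z' x x', is_image u z x -> is_image u z' x' -> z 0 -> z' 0 ->
    forall i, i < size (u true) + k -> x i = x' i.
Proof.
move=> H z z' x x' zx z'x' z0 z'0 i.
have zx0 := is_image_at _ _ _ 0 i zx; have zx0' := is_image_at _ _ _ 0 i z'x'.
rewrite add0n z0 in zx0; rewrite add0n z'0 in zx0'.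
have [iu _|ui ik] := ltnP i (size (u true)); first by rewrite zx0 ?zx0'.
have := H _ _ _ _ (is_image_tail _ _ _ 1 zx) (is_image_tail _ _ _ 1 z'x').
rewrite !image_prefix1 z0 z'0 => /(_ (i - size (u true))).
by rewrite /tail subnKC//; apply; lia.
Qed.

Lemma node_cons_factor c s z x : is_image (node (c :: s)) z x ->
  exists w, is_image (esubst c) z w /\ is_image (node s) w x.
Proof.
move=> zx; have [w zw] := is_image_exists _ z (esubst_nonerasing c).
have [x' wx'] := is_image_exists _ w (node_nonerasing s).
exists w; split => //.
suff -> : x = x' by [].
apply/funext; apply: is_image_uniq (node_nonerasing (c :: s)) zx _.
exact: is_image_comp wx' zw.
Qed.

(** Regardless of z, the last step [esubst true] makes the intermediate sequence
start with 1, which lengthens the known prefix by one full block. *)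
Lemma node_common_prefix_any s z z' x x' :
  is_image (node s) z x -> is_image (node s) z' x' ->
  forall i, i < (size (node s false)).-1 -> x i = x' i.
Proof.
elim: s z z' x x' => [//|c s IH] z z' x x'.
move=> /node_cons_factor[w [zw wx]] /node_cons_factor[w' [zw' wx']] i.
rewrite size_node_cons; case: c zw zw' => zw zw' /=; last first.
  by rewrite addn0; exact: (IH _ _ _ _ wx wx' i).
have w0 : w 0 by have := is_image_at _ _ _ 0 0 zw; case: (z 0) => ->.
have w'0 : w' 0 by have := is_image_at _ _ _ 0 0 zw'; case: (z' 0) => ->.
move=> ik; apply: (common_prefix_cons _ _ IH _ _ _ _ wx wx' w0 w'0).
by have := node_nonerasing s false; lia.
Qed.

(** The bound x + y - 1 grows with every step, even in a long run of one and the
same step, where one of the two lengths stays constant. *)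
Lemma node_common_prefix s z z' x x' :
  is_image (node s) z x -> is_image (node s) z' x' -> z 0 -> z' 0 ->
  forall i, i < (size (node s false) + size (node s true)).-1 -> x i = x' i.
Proof.
move=> zx z'x' z0 z'0 i ik.
apply: (common_prefix_cons _ _ (@node_common_prefix_any s) _ _ _ _ zx z'x' z0 z'0).
by have := node_nonerasing s false; lia.
Qed.

(** The sum x + y grows at each step but at most doubles; keeping it between M
and 2M leaves finitely many nodes. *)
Lemma cantor_kneading_node a M : cantor_kneading a -> 1 < M ->
  exists s z, [/\ cantor_kneading z, is_image (node s) z a &
    M <= size (node s false) + size (node s true) <= M.*2].
Proof.
move=> ka; elim: M => // M IH; rewrite ltnS leq_eqVlt => /orP[/eqP<-|M1].
  exists [::], a; split => // n i.
  rewrite /image_prefix /=.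
  have E : flatten [seq [:: a j] | j <- iota 0 n] = [seq a j | j <- iota 0 n].
    by elim: (iota 0 n) => //= j l ->.
  rewrite E size_map size_iota => ik.
  by rewrite (nth_map 0) ?size_iota// nth_iota.
have [s [z [kz za /andP[sM sM2]]]] := IH M1.
have [le|gt] := leqP M.+1 (size (node s false) + size (node s true)).
  by exists s, z; split => //; lia.
have [c [w [kw wz]]] := cantor_kneading_desubst _ kz.
exists (c :: s), w; split => //; first exact: is_image_comp za wz.
rewrite !size_node_cons.
by have := node_nonerasing s false; have := node_nonerasing s true;
  case: c {wz} => /=; lia.
Qed.

Local Open Scope classical_set_scope.
Local Open Scope ring_scope.

(** * The orbit of 1 and the bifurcation set *)

(** The orbit of 1 under the left-continuous version of the transformation,
x -> b x - (ceil (b x) - 1) on ]0, 1], which is 1-valued where the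
transformation vanishes. *)
Fixpoint orbit1 {R : realType} (b : R) (n : nat) : R :=
  if n is n'.+1 then b * orbit1 b n' - (1 < b * orbit1 b n')%R%:R else 1.

Definition kneading {R : realType} (b : R) (n : nat) : bool := 1 < b * orbit1 b n.

Lemma orbit1S {R : realType} (b : R) n :
  orbit1 b n.+1 = b * orbit1 b n - (kneading b n)%:R.
Proof. by []. Qed.

Lemma orbit1_itv {R : realType} (b : R) n : 1 < b < 2 -> 0 < orbit1 b n <= 1.
Proof.
move=> /andP[b1 b2]; elim: n => [|n /andP[t0 t1]]; first by rewrite ltr01 lexx.
rewrite orbit1S /kneading; have bt0 : 0 < b * orbit1 b n by rewrite mulr_gt0//; lra.
have bt2 : b * orbit1 b n <= b by rewrite ler_piMr//; lra.
by case: (ltP 1 (b * _)) => h /=; lra.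
Qed.

Lemma kneadingT {R : realType} (b : R) n : kneading b n -> 1 < b * orbit1 b n.
Proof. by []. Qed.

Lemma kneadingF {R : realType} (b : R) n :
  kneading b n = false -> b * orbit1 b n <= 1.
Proof. by move=> /negbT; rewrite /kneading -leNgt. Qed.

Lemma beta_transfE {R : realType} (b x : R) : 1 < b < 2 -> 0 <= x < 1 ->
  beta_transf b x = b * x - (1 <= b * x)%R%:R.
Proof.
move=> /andP[b1 b2] /andP[x0 x1]; rewrite /beta_transf.
have bx0 : 0 <= b * x by rewrite mulr_ge0//; lra.
have bx2 : b * x < 2 by rewrite (le_lt_trans _ b2)// ler_piMr//; lra.
case: (leP 1 (b * x)) => h /=; first by rewrite (@floor_def _ _ 1)// h.
by rewrite (@floor_def _ _ 0)// bx0.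
Qed.

Lemma beta_transf_itv {R : realType} (b x : R) : 0 <= beta_transf b x < 1.
Proof.
have := floor_itv (b * x); rewrite /beta_transf intrD => /andP[h1 h2].
by apply/andP; split; lra.
Qed.

Lemma iter_beta_itv {R : realType} (b x : R) n : 0 <= x < 1 ->
  0 <= iter n (beta_transf b) x < 1.
Proof. by case: n => // n _; rewrite iterS; apply: beta_transf_itv. Qed.

(** The number tau_i - b^i (1 - y) is the i-th point of the orbit of y as long
as y has the same digits as 1. It lies below tau_i <= 1, which settles the digits 0, and
above the same number for p, which settles the digits 1. *)
Lemma iter_beta_follow {R : realType} (b p y : R) (m : nat) : 1 < b < 2 ->
  (forall i, (i <= m)%N -> 0 <= orbit1 b i - b ^+ i * (1 - p)) ->
  p <= y < 1 ->
  forall i, (i <= m)%N ->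
    iter i (beta_transf b) y = orbit1 b i - b ^+ i * (1 - y).
Proof.
move=> b12 pge /andP[py y1]; have /andP[b1 b2] := b12.
have y0 : 0 <= y by have := pge 0%N isT; rewrite expr0 /=; lra.
elim=> [|i IH] im; first by rewrite expr0 /=; lra.
have bi0 : 0 < b ^+ i by rewrite exprn_gt0//; lra.
have E := IH (ltnW im).
have yi : 0 <= iter i (beta_transf b) y < 1 by apply: iter_beta_itv; rewrite y0.
rewrite iterS beta_transfE// E orbit1S exprS.
have -> : (1 <= b * (orbit1 b i - b ^+ i * (1 - y))) = kneading b i.
  case: (boolP (kneading b i)) => [/kneadingT k|/negbTE/kneadingF k].
    have h := pge _ im; rewrite orbit1S /kneading k /= exprS in h.
    have : b ^+ i.+1 * (1 - y) <= b ^+ i.+1 * (1 - p).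
      by rewrite ler_wpM2l//; [rewrite exprn_ge0; lra | lra].
    by rewrite exprS; lra.
  apply/negbTE; rewrite -ltNge.
  have : 0 < b ^+ i.+1 * (1 - y) by rewrite mulr_gt0 ?exprn_gt0//; lra.
  by rewrite exprS; lra.
by ring.
Qed.

(** The point p is the fixed point of the affine branch with digits
a_0, ..., a_(m-1), 0. Going backwards from p >= 0, its first m points are seen to be
nonnegative. *)
Lemma exists_periodic_point {R : realType} (b : R) (m : nat) : 1 < b < 2 ->
  kneading b m -> exists p,
  [/\ 0 <= p < 1, b * (orbit1 b m - b ^+ m * (1 - p)) = p &
      forall i, (i <= m)%N -> 0 <= orbit1 b i - b ^+ i * (1 - p)].
Proof.
move=> b12 /kneadingT km; have /andP[b1 b2] := b12.
have bge n : 1 <= b ^+ n by rewrite exprn_ege1//; lra.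
have bm : 1 < b ^+ m.+1 by rewrite exprS; have := bge m; nra.
(* d = 1 - p solves b (tau_m - b^m d) = 1 - d. *)
set d := (b * orbit1 b m - 1) / (b ^+ m.+1 - 1).
have dE : d * (b ^+ m.+1 - 1) = b * orbit1 b m - 1.
  by rewrite /d divfK//; lra.
have d0 : 0 < d by rewrite divr_gt0//; lra.
have /andP[om0 om1] := orbit1_itv b m b12.
have d1 : d <= 1.
  by rewrite ler_pdivrMr; last lra; rewrite exprS; have := bge m; nra.
have pE : b * (orbit1 b m - b ^+ m * (1 - (1 - d))) = 1 - d.
  by move: dE; rewrite exprS; lra.
exists (1 - d); split => //; first by lra.
suff H k : (k <= m)%N -> 0 <= orbit1 b (m - k) - b ^+ (m - k) * (1 - (1 - d)).
  by move=> i im; have := H (m - i)%N (leq_subr _ _); rewrite subKn.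
elim: k => [_|k IH km'].
  rewrite subn0 -(pmulr_rge0 _ (_ : 0 < b)); last by lra.
  by rewrite pE; lra.
have := IH (ltnW km'); have -> : (m - k = (m - k.+1).+1)%N by lia.
rewrite orbit1S exprS; set i := (m - k.+1)%N => h.
rewrite -(pmulr_rge0 _ (_ : 0 < b)); last by lra.
have : 0 <= (kneading b i)%:R :> R by rewrite ler0n.
by move: h; lra.
Qed.

(** Discontinuities of the transformation are mapped to 0, so an orbit that never
meets 0 avoids them. *)
Lemma iter_beta_locally_affine {R : realType} (b t : R) (N : nat) : 1 < b < 2 ->
  t < 1 -> (forall i, 0 < iter i (beta_transf b) t) ->
  exists2 e, 0 < e & forall x, `|x - t| < e ->
    0 <= x < 1 /\ forall i, (i <= N)%N ->
      iter i (beta_transf b) x = iter i (beta_transf b) t + b ^+ i * (x - t).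
Proof.
move=> b12 t1 tpos; have /andP[b1 b2] := b12; have t0 := tpos 0%N.
have t01 : 0 <= t < 1 by rewrite t1 ltW.
elim: N => [|N [e e0 IH]].
  exists (Num.min t (1 - t)); first by rewrite lt_min t0; lra.
  move=> x; rewrite lt_min !ltr_norml /= in t0 * => h.
  split; first by lra.
  by case=> // _; rewrite expr0 /=; lra.
set z := iter N (beta_transf b) t in IH.
have z01 : 0 <= z < 1 by apply: iter_beta_itv.
have bN0 : 0 < b ^+ N.+1 by rewrite exprn_gt0//; lra.
have bz : b * z - 1 != 0.
  apply/eqP => bz1; have := tpos N.+1; rewrite iterS -/z beta_transfE//.
  have -> : b * z = 1 by lra.
  by rewrite lexx subrr ltxx.
exists (Num.min e (`|b * z - 1| / b ^+ N.+1)).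
  by rewrite lt_min e0 divr_gt0// normr_gt0.
move=> x; rewrite lt_min => /andP[xe]; rewrite ltr_pdivlMr// => xz.
have [x01 H] := IH _ xe; split => // i.
rewrite leq_eqVlt => /orP[/eqP->|/H//].
have xN : 0 <= iter N (beta_transf b) x < 1 by apply: iter_beta_itv.
rewrite !iterS beta_transfE// [in RHS]beta_transfE// H// -/z.
have -> : (1 <= b * (z + b ^+ N * (x - t))) = (1 <= b * z).
  have : `|b ^+ N.+1 * (x - t)| < `|b * z - 1|.
    by rewrite normrM (gtr0_norm bN0) mulrC.
  rewrite exprS ltr_norml.
  case: (leP 1 (b * z)) => h.
    by rewrite ger0_norm; last lra; move=> /andP[h1 h2]; lra.
  rewrite ltr0_norm; last lra.
  by move=> /andP[h1 h2]; apply/negbTE; rewrite -ltNge; lra.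
by rewrite exprS; ring.
Qed.

Lemma perfect_closure_approx {R : realType} (A : set R) (t e : R) :
  perfect_set (closure A) -> A t -> 0 < e ->
  exists x, [/\ A x, x != t & `|x - t| < e].
Proof.
move=> [_ lim] At e0.
have : limit_point (closure A) t by rewrite lim; apply: subset_closure.
move=> /(_ (ball t e)); case; first exact: nbhsx_ballx.
move=> y [yt cy]; rewrite /ball /= => tye.
have d0 : 0 < `|t - y| by rewrite normr_gt0 subr_eq0 eq_sym.
(* A ball around y that is inside the ball around t and avoids t. *)
pose d := Num.min `|t - y| (e - `|t - y|).
have dpos : 0 < d by rewrite lt_min d0 subr_gt0.
have [x [Ax]] := cy (ball y d) (nbhsx_ballx _ _ dpos).
rewrite /ball /= lt_min => /andP[h1 h2]; exists x; split => //.
  by apply: contraTneq h1 => ->; rewrite distrC ltxx.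
have := ler_normD (x - y) (y - t).
rewrite (_ : x - y + (y - t) = x - t); last by ring.
rewrite (distrC x y) (distrC y t); lra.
Qed.

Lemma expr_ge_linear {R : realType} (b : R) (n : nat) : 1 < b ->
  n%:R * (b - 1) <= b ^+ n.
Proof.
move=> b1; elim: n => [|n IH]; first by rewrite mul0r expr0.
have bn : 1 <= b ^+ n by rewrite exprn_ege1//; lra.
have : 0 <= (b - 1) * (b ^+ n - 1) by rewrite mulr_ge0//; lra.
by rewrite -natr1 exprS; lra.
Qed.

Lemma exists_expr_gt {R : realType} (b K : R) : 1 < b -> exists n, K < b ^+ n.
Proof.
move=> b1; exists (Num.trunc (Num.max 0 (K / (b - 1)))).+1.
apply: lt_le_trans (expr_ge_linear _ _ b1).
rewrite -ltr_pdivrMr ?subr_gt0//.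
apply: le_lt_trans (truncnS_gt (Num.max 0 (K / (b - 1)))).
by rewrite le_max lexx orbT.
Qed.

(** A perfect bifurcation set has no isolated point, in particular the least
point t of a periodic orbit is not isolated. By expansion, nearby points of the
bifurcation set cannot lie on its left; those on its right escape from the
periodic orbit, and when the escape happens the next visited point is below
tau_(m+1). If tau_(m+1) <= t, this is absurd: a point x > t of the bifurcation
set never visits a point below x. *)
Lemma periodic_orbit_below {R : realType} (b p : R) (m : nat) : 1 < b < 2 ->
  perfect_set (closure (E_plus b)) -> 0 <= p < 1 ->
  b * (orbit1 b m - b ^+ m * (1 - p)) = p ->
  (forall i, (i <= m)%N -> 0 <= orbit1 b i - b ^+ i * (1 - p)) ->
  iter m.+1 (beta_transf b) p = p ->
  kneading b m ->
  exists2 r, (r <= m)%N & iter r (beta_transf b) p < orbit1 b m.+1.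
Proof.
move=> b12 perf p01 pfix pfol pper km; have /andP[b1 b2] := b12.
set T := beta_transf b in pper *.
have Tmod k : iter k T p = iter (k %% m.+1) T p.
  rewrite {1}(divn_eq k m.+1) addnC iterD; congr (iter _ _ _).
  by elim: (k %/ m.+1)%N => // q IH; rewrite mulSn iterD IH pper.
pose f (i : 'I_m.+1) := iter i T p.
have [r _ rmin] := @arg_minP _ _ _ (@ord0 m) xpredT f isT.
exists r; first by rewrite -ltnS.
set t := iter r T p; rewrite ltNge; apply/negP => tle.
have tmin k : t <= iter k T p.
  by rewrite Tmod; apply: (rmin (Ordinal (ltn_pmod k (ltn0Sn m)))).
have t01 : 0 <= t < 1 by apply: iter_beta_itv.
have Et : E_plus b t by split => // n; rewrite /t -iterD.
have /andP[tau0 tau1] := orbit1_itv b m.+1 b12.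
have tpos i : 0 < iter i T t.
  by rewrite /t -iterD; apply: lt_le_trans (tmin _); apply: lt_le_trans tle.
have t1 : t < 1 by case/andP: t01.
have [e e0 eP] := iter_beta_locally_affine b t m.+1 b12 t1 tpos.
have [x [[_ Ex] xt xe]] := perfect_closure_approx _ _ _ perf Et e0.
have [x01 aff] := eP x xe.
have bm : 1 < b ^+ m.+1 by rewrite exprn_egt1.
have tper : iter m.+1 T t = t by rewrite /t -iterD addnC iterD pper.
have [xlt|xgt|xeq] := ltgtP x t; last by rewrite xeq eqxx in xt.
  (* Here T^(m+1) x < x, as T^(m+1) expands around its fixed point t. *)
  have := Ex m.+1; rewrite aff// -/T tper.
  have : (b ^+ m.+1 - 1) * (x - t) < 0 by rewrite pmulr_rlt0; lra.
  by lra.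
(* Move x next to p, and follow it while its distance to p is multiplied by
   b^(m+1) in each period. *)
pose s := (m.+1 - r)%N; pose y0 := iter s T x.
have bs0 : 0 < b ^+ s by rewrite exprn_gt0//; lra.
have y0E : y0 = p + b ^+ s * (x - t).
  rewrite /y0 aff ?leq_subr// -/T /t -iterD subnK ?pper//.
  by apply: ltnW.
have xT k : t < iter k T x by apply: lt_le_trans (Ex k).
have growth l : iter (l * m.+1) T y0 = p + b ^+ (l * m.+1) * (y0 - p).
  elim: l => [|l IH]; first by rewrite mul0n expr0 /=; ring.
  rewrite mulSn iterD.
  have y01 : 0 <= iter (l * m.+1) T y0 < 1.
    by rewrite /y0 -iterD; apply: iter_beta_itv.
  have yp : p < iter (l * m.+1) T y0.
    rewrite IH ltrDl mulr_gt0 ?exprn_gt0//; first by lra.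
    by rewrite y0E addrAC subrr add0r mulr_gt0//; lra.
  have yI : p <= iter (l * m.+1) T y0 < 1 by lra.
  have fol := iter_beta_follow b p _ m b12 pfol yI m (leqnn _).
  have := xT (m.+1 + (l * m.+1 + s))%N; rewrite !iterD -/y0.
  set y := iter (l * m.+1) T y0 in IH y01 yp yI fol *.
  have ym01 : 0 <= iter m T y < 1 by apply: iter_beta_itv.
  rewrite iterS [T (iter m T y)](beta_transfE b _ b12 ym01) fol.
  (* With the digit 1 the orbit drops below tau_(m+1), hence below t. *)
  case: (leP 1 (b * _)) => h /=.
    have k1 : orbit1 b m.+1 = b * orbit1 b m - 1 by rewrite orbit1S km.
    have : 0 < b ^+ m.+1 * (1 - y) by rewrite mulr_gt0//; lra.
    by rewrite exprS; lra.
  move=> _; rewrite exprD -mulrA.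
  have -> : b ^+ (l * m.+1) * (y0 - p) = y - p by rewrite IH; ring.
  by move: pfix; rewrite exprS; lra.
have d0 : 0 < y0 - p by rewrite y0E addrAC subrr add0r mulr_gt0//; lra.
have [l lP] := exists_expr_gt _ (1 / (y0 - p)) bm.
rewrite ltr_pdivrMr// -exprM mulnC in lP.
have := growth l.
have /andP[_] : 0 <= iter (l * m.+1) T y0 < 1.
  by rewrite /y0 -iterD; apply: iter_beta_itv.
by lra.
Qed.

(** The orbit of 1 starts at its maximum, and a smaller quasi-greedy digit at
the first difference would reverse the order of the points. *)
Lemma orbit1_lexmax {R : realType} (b : R) (i : nat) : 1 < b < 2 ->
  ~ lexlt (kneading b) (tail i (kneading b)).
Proof.
move=> b12 [k [eqk /kneadingF k0 /kneadingT k1]]; have /andP[b1 b2] := b12.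
have D j : (j <= k)%N -> 0 <= orbit1 b j - orbit1 b (i + j).
  elim: j => [_|j IH jk].
    by rewrite addn0 /=; have := orbit1_itv b i b12; lra.
  rewrite addnS !orbit1S -/(tail i _ j) -eqk//.
  have : 0 <= b * (orbit1 b j - orbit1 b (i + j)).
    by rewrite mulr_ge0 ?IH//; [lra | exact: ltnW].
  by rewrite /tail; lra.
have : 0 <= b * (orbit1 b k - orbit1 b (i + k)).
  by rewrite mulr_ge0 ?D//; lra.
by lra.
Qed.

(** Comparing the greedy digits of x with quasi-greedy ones is consistent: at
the first difference a digit 0 of the latter forces a value at most 1 of b
times the point, a digit 1 of the former a value at least 1. *)
Lemma orbit1_lexlt {R : realType} (b x : R) (n : nat) : 1 < b < 2 ->
  0 <= x < 1 -> x < orbit1 b n ->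
  ~ lexlt (tail n (kneading b)) (fun i => 1 <= b * iter i (beta_transf b) x).
Proof.
move=> b12 x01 xn [k [eqk /kneadingF k0 k1]]; have /andP[b1 b2] := b12.
have D j : (j <= k)%N -> iter j (beta_transf b) x < orbit1 b (n + j).
  elim: j => [_|j IH jk]; first by rewrite addn0.
  have xj : 0 <= iter j (beta_transf b) x < 1 by apply: iter_beta_itv.
  rewrite addnS orbit1S iterS beta_transfE// -eqk// /tail.
  have : 0 < b * (orbit1 b (n + j) - iter j (beta_transf b) x).
    by rewrite mulr_gt0 ?subr_gt0 ?IH//; [lra | exact: ltnW].
  by lra.
have : 0 < b * (orbit1 b (n + k) - iter k (beta_transf b) x).
  by rewrite mulr_gt0 ?subr_gt0 ?D//; lra.
by lra.
Qed.

Lemma perfect_cantor_kneading {R : realType} (b : R) : 1 < b < 2 ->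
  perfect_set (closure (E_plus b)) -> cantor_kneading (kneading b).
Proof.
move=> b12 perf; have /andP[b1 b2] := b12; split.
- by rewrite /kneading /= mulr1.
- by move=> i; apply: orbit1_lexmax.
move=> m y km yper yk ym.
have [p [p01 pfix pfol]] := exists_periodic_point b m b12 km.
have pI : p <= p < 1 by lra.
have fol := iter_beta_follow b p p m b12 pfol pI.
have pper : iter m.+1 (beta_transf b) p = p.
  have pm : 0 <= iter m (beta_transf b) p < 1 by apply: iter_beta_itv.
  rewrite iterS beta_transfE// fol// pfix.
  have -> /= : (1 <= p) = false by apply/negbTE; rewrite -ltNge; lra.
  by rewrite subr0.
have [r rm rlt] := periodic_orbit_below b p m b12 perf p01 pfix pfol pper km.
have yE i : y i = (1 <= b * iter i (beta_transf b) p).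
  elim/ltn_ind: i => i IH; have [im|im] := ltnP i m.+1; last first.
    rewrite -(subnKC im) yper addnC iterD pper; apply: IH; lia.
  move: im; rewrite ltnS leq_eqVlt => /orP[/eqP->|im].
    by rewrite fol// pfix ym; apply/esym/negbTE; rewrite -ltNge; lra.
  rewrite yk// fol; last exact: ltnW.
  have := fol _ im.
  have pi : 0 <= iter i (beta_transf b) p < 1 by apply: iter_beta_itv.
  rewrite iterS beta_transfE// (fol _ (ltnW im)) orbit1S exprS.
  case: (leP 1 (b * (_ - _))) => h; case: (kneading b i) => //=; lra.
exists r; have := orbit1_lexlt b _ m.+1 b12 (iter_beta_itv b p r p01) rlt.
suff -> : tail r y =
    (fun i => 1 <= b * iter i (beta_transf b) (iter r (beta_transf b) p)) by [].
by apply/funext => i; rewrite /tail yE addnC iterD.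
Qed.

(** Both orbits start at 1, and under equal digits their distance is multiplied by at
least b in each step; it is c - b after one step and never exceeds 1. *)
Lemma kneading_close {R : realType} (b c : R) (L : nat) : 1 < b -> b < c -> c < 2 ->
  (forall i, (i <= L)%N -> kneading b i = kneading c i) ->
  b ^+ L * (c - b) <= 1.
Proof.
move=> b1 bc c2 eqk; have b12 : 1 < b < 2 by lra.
have c12 : 1 < c < 2 by lra.
have D i : (i <= L)%N -> b ^+ i * (c - b) <= orbit1 c i.+1 - orbit1 b i.+1.
  elim: i => [|i IH] iL.
    by rewrite !orbit1S (eqk 0%N)//= expr0; lra.
  have := IH (ltnW iL); rewrite [orbit1 c i.+2]orbit1S [orbit1 b i.+2]orbit1S.
  rewrite (eqk i.+1)// exprS => H.
  have /andP[oc _] := orbit1_itv c i.+1 c12.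
  have : b * (b ^+ i * (c - b)) <= b * (orbit1 c i.+1 - orbit1 b i.+1).
    by rewrite ler_wpM2l//; lra.
  have : 0 <= (c - b) * orbit1 c i.+1 by rewrite mulr_ge0//; lra.
  by lra.
have := D L (leqnn _).
have := orbit1_itv c L.+1 c12; have := orbit1_itv b L.+1 b12.
by lra.
Qed.

(** * Sets of zero Hausdorff measure *)

(** The s-dimensional Hausdorff measure of A is 0; spelling out the covers
makes countable unions accessible to an epsilon argument. *)
Definition hausdorff_null {R : realType} (s : R) (A : set R) : Prop :=
  forall delta eps : R, 0 < delta -> 0 < eps ->
  exists U : (set R)^nat, [/\ A `<=` \bigcup_i U i,
    forall i, (diameter (U i) <= delta%:E)%E &
    (\sum_(0 <= i <oo) diam_pow s (U i) <= eps%:E)%E].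

Lemma diam_pow_ge0 {R : realType} (s : R) (A : set R) : (0 <= diam_pow s A)%E.
Proof. by rewrite /diam_pow; case: ifP => // _; apply: poweR_ge0. Qed.

Lemma diam_pow_le {R : realType} (s d : R) (A : set R) : 0 < s -> 0 <= d ->
  (diameter A <= d%:E)%E -> (diam_pow s A <= (d `^ s)%:E)%E.
Proof.
move=> s0 d0 Ad; rewrite /diam_pow; case: ifPn => [_|/set0P[x Ax]].
  by rewrite lee_fin powR_ge0.
have D0 : (0 <= diameter A)%E.
  by apply: ereal_sup_ubound; exists (x, x) => //=; rewrite subrr normr0.
rewrite -poweR_EFin; apply: gt0_ler_poweR => //; first exact: ltW.
  by rewrite in_itv /= D0 leey.
by rewrite in_itv /= lee_fin d0 leey.
Qed.

Lemma hausdorff_null_measure {R : realType} (s : R) (A : set R) :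
  hausdorff_null s A -> hausdorff_measure s A = 0%E.
Proof.
move=> nA; have content0 d : 0 < d -> hausdorff_content s d A = 0%E.
  move=> d0; apply/eqP; rewrite eq_le; apply/andP; split; last first.
    apply: le_ereal_inf_tmp => _ [U _ <-].
    by apply: nneseries_ge0 => i _ _; apply: diam_pow_ge0.
  apply/lee_addgt0Pr => e e0; rewrite add0e.
  have [U [AU Ud Ue]] := nA d e d0 e0.
  by apply: le_trans Ue; apply: ereal_inf_lbound; exists U.
rewrite /hausdorff_measure (_ : [set _ | _ in _] = [set 0%E]) ?ereal_sup1//.
apply/seteqP; split => [_ [d d0 <-]|_ ->]; first by rewrite /= content0.
by exists 1; rewrite ?content0 /=.
Qed.

Lemma hausdorff_dim_eq0 {R : realType} (A : set R) :
  (forall s, 0 < s -> hausdorff_null s A) -> hausdorff_dim A = 0%E.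
Proof.
move=> nA; apply/eqP; rewrite eq_le; apply/andP; split; last first.
  by apply: le_ereal_inf_tmp => _ [s [s0 _] <-]; rewrite lee_fin.
apply/lee_addgt0Pr => s s0; rewrite add0e; apply: ereal_inf_lbound.
by exists s => //; split; [exact: ltW | exact: hausdorff_null_measure (nA s s0)].
Qed.

(** Give the j-th set a cover of total weight eps / 2^(j+1) and enumerate all covers by
a bijection between nat and nat * nat. *)
Lemma hausdorff_null_bigcup {R : realType} (s : R) (A : (set R)^nat) :
  (forall j, hausdorff_null s (A j)) -> hausdorff_null s (\bigcup_j A j).
Proof.
move=> nA delta eps delta0 eps0.
have [G PG] : {G : ((set R)^nat)^nat & forall j, [/\ A j `<=` \bigcup_i G j i,
    forall i, (diameter (G j i) <= delta%:E)%E &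
    (\sum_(0 <= i <oo) diam_pow s (G j i) <= (eps / (2 ^ j.+1)%:R)%:E)%E]}.
  apply: (@choice _ _ (fun j U => [/\ A j `<=` \bigcup_i U i,
    forall i, (diameter (U i) <= delta%:E)%E &
    (\sum_(0 <= i <oo) diam_pow s (U i) <= (eps / (2 ^ j.+1)%:R)%:E)%E])) => j.
  by apply: nA => //; rewrite divr_gt0// ltr0n expn_gt0.
have g0 (x : nat * nat) : (0 <= (diam_pow s \o uncurry G) x)%E.
  exact: diam_pow_ge0.
have /card_esym/ppcard_eqP[f] := card_nat2.
exists (uncurry G \o f); split.
- move=> t [j _ Ajt]; have [/(_ t Ajt)[i _ Gjit] _ _] := PG j.
  by exists (f^-1%FUN (j, i)) => //=; rewrite invK ?inE.
- by move=> i /=; have [_ + _] := PG (f i).1; case: (f i) => a b; apply.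
apply: (@le_trans _ _ (\esum_(i in setT) (diam_pow s \o uncurry G) i)).
  rewrite -(esum_pred_image (diam_pow s \o uncurry G) _ xpredT) ?[fun=> _]set_true//.
  by rewrite image_eq.
rewrite (_ : esum _ _ = \esum_(i in setT) \esum_(j in setT) diam_pow s (G i j))%E;
  last first.
  rewrite esum_esum; last by move=> *; apply: diam_pow_ge0.
  rewrite (_ : setT = setT `*`` (fun=> setT)); last by apply/seteqP; split.
  by apply: eq_esum => -[].
rewrite -nneseries_esumT; last first.
  by move=> i; apply: esum_ge0 => j _; apply: diam_pow_ge0.
apply: le_trans (epsilon_trick0 xpredT (ltW eps0)).
apply: lee_nneseries => [i _ _|i _].
  by apply: esum_ge0 => j _; apply: diam_pow_ge0.
rewrite -nneseries_esumT; first by case: (PG i).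
by move=> j; apply: diam_pow_ge0.
Qed.

Lemma hausdorff_null_finite_covers {R : realType} (s : R) (A : set R) : 0 < s ->
  (forall delta eps : R, 0 < delta -> 0 < eps ->
     exists (N : nat) (d : R) (U : (set R)^nat),
       [/\ 0 <= d <= delta, N%:R * d `^ s <= eps, A `<=` \bigcup_i U i,
           forall i, (diameter (U i) <= d%:E)%E &
           forall i, (N <= i)%N -> U i = set0]) ->
  hausdorff_null s A.
Proof.
move=> s0 H delta eps delta0 eps0.
have [N [d [U [/andP[d0 dd] Nd AU Ud U0]]]] := H delta eps delta0 eps0.
exists U; split => //.
  by move=> i; apply: le_trans (Ud i) _; rewrite lee_fin.
rewrite (nneseries_split 0 N) => [|i _]; last exact: diam_pow_ge0.
rewrite [X in (_ + X)%E]eseries0 => [|i /= Ni _]; last first.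
  by rewrite U0 ?/diam_pow ?eqxx.
rewrite adde0; apply: le_trans (_ : (N%:R * d `^ s)%:E <= _)%E; last first.
  by rewrite lee_fin.
rewrite add0n mulr_natl -[N in (_ *+ N)]subn0 -sumr_const_nat -sumEFin.
by apply: lee_sum => i _; apply: diam_pow_le.
Qed.

(** By the Bernoulli inequality r^k >= k (r - 1), so r^(3k) grows at least like
k^3; the constant 121 comes from 6 k + 5 <= 11 k. *)
Lemma expr_ge_quadratic {R : realType} (r C : R) : 1 < r -> 0 <= C ->
  exists n, C * (n.*2 + 5)%:R ^+ 2 <= r ^+ n.
Proof.
move=> r1 C0; have h0 : 0 < r - 1 by lra.
have B n := expr_ge_linear r n r1.
pose k := (Num.trunc (121 * C / (r - 1) ^+ 3)).+1.
have kC : 121 * C <= k%:R * (r - 1) ^+ 3.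
  by rewrite -ler_pdivrMr ?exprn_gt0//; apply/ltW/truncnS_gt.
exists (k * 3)%N; rewrite exprM.
have k1 : 1 <= k%:R :> R by rewrite ler1n.
apply: (@le_trans _ _ ((k%:R * (r - 1)) ^+ 3)); last first.
  by rewrite lerXn2r ?nnegrE ?B ?exprn_ge0 ?mulr_ge0//; lra.
apply: (@le_trans _ _ (C * (11 * k%:R) ^+ 2)).
  rewrite ler_wpM2l// lerXn2r ?nnegrE ?ler0n ?mulr_ge0//.
  by rewrite -natrM ler_nat /k; lia.
rewrite !exprMn (_ : 11 ^+ 2 = 121 :> R); last by rewrite expr2 -natrM.
have : 0 <= k%:R ^+ 2 * (k%:R * (r - 1) ^+ 3 - 121 * C).
  by rewrite mulr_ge0 ?exprn_ge0//; lra.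
by rewrite (exprS k%:R 2); lra.
Qed.

(** * Covers by sets of bases sharing a renormalization *)

(** By [node_inj] the pair (x, y) determines the node, hence the first x + y - 1
letters of the kneading sequences. *)
Definition kneading_cylinder {R : realType} (rho : R) (M x y : nat) : set R :=
  [set b : R | rho <= b < 2 /\ exists (s : seq bool) (z : nat -> bool),
    [/\ z 0%N, is_image (node s) z (kneading b),
        size (node s false) = x, size (node s true) = y & (M <= x + y)%N]].

Lemma diameter_kneading_cylinder {R : realType} (rho : R) (n x y : nat) :
  1 < rho ->
  (diameter (kneading_cylinder rho n.+2 x y) <= (rho ^- n)%:E)%E.
Proof.
move=> rho1; apply: ge_ereal_sup => _ [[b c] [/= Ub Uc] <-]; rewrite lee_fin.
have rhon : 0 < rho ^+ n by rewrite exprn_gt0//; lra.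
wlog bc : b c Ub Uc / b < c.
  move=> W; have [bc|cb|->] := ltgtP b c; first exact: W.
    by rewrite distrC; apply: W.
  by rewrite subrr normr0 invr_ge0 ltW.
have [/andP[rb b2] [s [z [z0 zb sx sy xy]]]] := Ub.
have [/andP[rc c2] [s' [z' [z'0 z'c sx' sy' _]]]] := Uc.
have ss : s' = s by apply: node_inj => -[]; rewrite ?sx ?sy ?sx' ?sy'.
rewrite {}ss in z'c sx' sy'.
rewrite ltr0_norm ?subr_lt0// opprB -[leRHS]mul1r ler_pdivlMr// mulrC.
have b1 : 1 < b by lra.
apply: le_trans (_ : b ^+ n * (c - b) <= 1).
  by rewrite ler_wpM2r ?lerXn2r ?nnegrE//; lra.
apply: kneading_close => // i iL.
apply: node_common_prefix zb z'c z0 z'0 _ _.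
by rewrite sx sy; lia.
Qed.

(** With M = n + 2 the nodes with M <= x + y <= 2M fit into a square of side
K = 2M + 1 = 2n + 5, and the cylinders have diameter at most rho^(-n). The minimum of rho and
rho^s controls at once this diameter and its s-th power. *)
Lemma hausdorff_null_cantor_kneading {R : realType} (s rho : R) :
  0 < s -> 1 < rho ->
  hausdorff_null s [set b : R | rho <= b < 2 /\ cantor_kneading (kneading b)].
Proof.
move=> s0 rho1; apply: hausdorff_null_finite_covers => // delta eps d0 e0.
have rhos : 1 < rho `^ s.
  by rewrite /powR ifF ?expR_gt1 ?mulr_gt0 ?ln_gt0//; apply/negbTE; lra.
(* C K^2 <= q^n gives both q^-n <= delta and K^2 q^-n <= eps. *)
pose C := delta^-1 + eps^-1.
have C0 : 0 <= C by rewrite addr_ge0// invr_ge0 ltW.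
have rC : 1 < Num.min rho (rho `^ s) by rewrite lt_min rho1.
have [n nP] := expr_ge_quadratic _ C rC C0.
set K := (n.*2 + 5)%N in nP.
have K1 : 1 <= K%:R ^+ 2 :> R by rewrite exprn_ege1// ler1n /K; lia.
have rn q : Num.min rho (rho `^ s) <= q -> C * K%:R ^+ 2 <= q ^+ n.
  move=> rq; apply: le_trans nP _.
  by rewrite lerXn2r ?nnegrE//; lra.
have rhon : 0 < rho ^+ n by rewrite exprn_gt0//; lra.
have rhosn : 0 < (rho `^ s) ^+ n by rewrite exprn_gt0//; lra.
exists (K ^ 2)%N, (rho ^- n),
  (fun i => if (i < K ^ 2)%N then kneading_cylinder rho n.+2 (i %% K) (i %/ K)
            else set0); split.
- rewrite invr_ge0 ltW//= -[leRHS]invrK lef_pV2 ?posrE ?invr_gt0//.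
  apply: le_trans (rn rho _); last by rewrite ge_min lexx.
  rewrite mulrDl -[leLHS]mulr1.
  have : delta^-1 * 1 <= delta^-1 * K%:R ^+ 2 by rewrite ler_wpM2l// invr_ge0 ltW.
  have : 0 <= eps^-1 * K%:R ^+ 2 by rewrite mulr_ge0 ?invr_ge0 ?exprn_ge0// ltW.
  by lra.
- have -> : (rho ^- n) `^ s = ((rho `^ s) ^+ n)^-1.
    rewrite -powR_invn; last by lra.
    by rewrite -powRrM mulrC powRrM powR_invn// powR_ge0.
  rewrite ler_pdivrMr// natrX.
  have := rn (rho `^ s); rewrite ge_min lexx orbT => /(_ isT) h.
  rewrite -(ler_pM2l (_ : 0 < eps^-1)) ?invr_gt0//.
  rewrite mulKf ?gt_eqF//; apply: le_trans h.
  by rewrite ler_wpM2r ?exprn_ge0// lerDr invr_ge0 ltW.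
- move=> b [b2 kb]; have [|t [z [kz zb /andP[M1 M2]]]] := cantor_kneading_node _ n.+2 kb.
    by [].
  have xyK : (size (node t false) + size (node t true) < K)%N.
    by apply: leq_ltn_trans M2 _; rewrite /K !doubleS !addnS addn0.
  have xK : (size (node t false) < K)%N := leq_ltn_trans (leq_addr _ _) xyK.
  have yK : (size (node t true) < K)%N := leq_ltn_trans (leq_addl _ _) xyK.
  exists (size (node t true) * K + size (node t false))%N => //.
  rewrite ifT; last first.
    rewrite expnS expn1; apply: leq_trans (_ : (size (node t true)).+1 * K <= _)%N.
      by rewrite mulSn addnC ltn_add2r.
    by rewrite leq_mul2r yK orbT.
  rewrite modnMDl modn_small// divnMDl; last by rewrite /K addnS.
  rewrite divn_small// addn0; split => //; exists t, z; split => //.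
  by case: kz.
- move=> i; case: ifP => _; first exact: diameter_kneading_cylinder.
  by apply: ge_ereal_sup => _ [p [[]]].
- by move=> i iK; rewrite ltnNge iK.
Qed.

Theorem theorem3 (R : realType) :
  hausdorff_dim [set b : R | 1 < b < 2 /\ cantor_set (closure (E_plus b))]
  = 0%E.
Proof.
apply: hausdorff_dim_eq0 => s s0.
pose rho (j : nat) : R := 1 + j.+1%:R^-1.
pose A j : set R := [set b | rho j <= b < 2 /\ cantor_kneading (kneading b)].
have rho1 j : 1 < rho j by rewrite ltrDl invr_gt0 ltr0n.
have nA : hausdorff_null s (\bigcup_j A j).
  by apply: hausdorff_null_bigcup => j; apply: hausdorff_null_cantor_kneading.
move=> delta eps d0 e0; have [U [AU Ud Ue]] := nA delta eps d0 e0.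
exists U; split => // b [b12 [_ _ perf _]]; apply: AU.
have /andP[b1 b2] := b12.
exists (Num.trunc (b - 1)^-1) => //; split; last exact: perfect_cantor_kneading.
rewrite b2 andbT /rho addrC -lerBrDr.
rewrite -[leRHS]invrK lef_pV2 ?posrE ?invr_gt0 ?subr_gt0 ?ltr0n//.
exact/ltW/truncnS_gt.
Qed.
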